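(* Let $\mathcal V$ be an algebra of difference functions in one variable $u$ in which $u$ is invertible, and let $$K(S)=u\,\frac{S-1}{S+1}\circ u,\qquad H(S)=S-S^{-1}.$$ There exists an infinite Lenard–Magri sequence $\xi_0=\frac1u,\xi_1,\xi_2,\dots$ of elements of $\mathcal V$ for the operators $K(S)$ and $H(S)$, i.e. such that $K(S)\xi_j=H(S)\xi_{j-1}$ for all $j\ge1$, where this relation means $$(S-1)(u\xi_j)=(S+1)\Big(\frac1u\,(S-S^{-1})(\xi_{j-1})\Big),\qquad j=1,2,\dots$$
   Context: The base field $\mathbb F$ has characteristic $0$. The algebra of difference polynomials in $u$ is $\mathcal V_1=\mathbb F[u_n\mid n\in\mathbb Z]$, $u=u_0$, with automorphism $S(u_n)=u_{n+1}$. An algebra of difference functions in $u$ is a commutative associative algebra extension $\mathcal V$ of $\mathcal V_1$, with an automorphism extending $S$ and commuting derivations extending $\frac{\partial}{\partial u_n}$, such that for each $f\in\mathcal V$ one has $\frac{\partial f}{\partial u_n}=0$ for all but finitely many $n$, and $S\circ\frac{\partial}{\partial u_n}=\frac{\partial}{\partial u_{n+1}}\circ S$. Difference operators $\sum_na_nS^n$ (finite sums) act on $\mathcal V$ by $f\mapsto\sum_na_nS^n(f)$. *)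

(* Defs.v *)
From HB Require Import structures.
From mathcomp Require Import all_boot all_order all_algebra.
From mathcomp Require Import finmap.
From mathcomp Require Import monalg.

Set Implicit Arguments.
Unset Strict Implicit.
Unset Printing Implicit Defensive.

Import GRing.Theory.
Local Open Scope ring_scope.

(* F[u_n | n in Z], as the monoid algebra over F of the commutative monomials *)
(* in variables indexed by int.                                               *)
Notation diffpoly F := {malg F[cmonom int]}.

Section DifferencePolynomials.
Variable F : fieldType.

Definition dp_var (n : int) : diffpoly F := << ucm n >>.

(* evaluation at u_n := u_(n+1) *)
Definition dp_shift (p : diffpoly F) : diffpoly F :=
  mmap (@malgC (cmonom int) F)
       (fun m : cmonom int =>
          \prod_(i <- finsupp m) dp_var (i + 1) ^+ m i) p.

(* c u_n^k m' |-> k c u_n^(k-1) m'; [divcm] is truncated at 0, but the term   *)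
(* vanishes when k = 0.                                                       *)
Definition dp_deriv (n : int) (p : diffpoly F) : diffpoly F :=
  \sum_(m <- msupp p) << p@_m *+ m n *g divcm m (ucm n) >>.

End DifferencePolynomials.

(* [dfa_emb] is the inclusion of the difference polynomials, [dfa_Sinv] the   *)
(* inverse of [dfa_S], and [dfa_D n] the derivation d/du_n.                   *)
Record diffFunAlg (F : fieldType) (V : comUnitAlgType F) := DiffFunAlg {
  dfa_emb : {lrmorphism diffpoly F -> V};
  dfa_S : {lrmorphism V -> V};
  dfa_Sinv : {lrmorphism V -> V};
  dfa_D : int -> {linear V -> V};
  dfa_emb_inj : injective dfa_emb;
  dfa_SK : cancel dfa_S dfa_Sinv;
  dfa_SinvK : cancel dfa_Sinv dfa_S;
  dfa_S_emb : forall p, dfa_S (dfa_emb p) = dfa_emb (dp_shift p);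
  dfa_D_leibniz : forall n f g, dfa_D n (f * g) = dfa_D n f * g + f * dfa_D n g;
  dfa_D_comm : forall m n f, dfa_D m (dfa_D n f) = dfa_D n (dfa_D m f);
  dfa_D_emb : forall n p, dfa_D n (dfa_emb p) = dfa_emb (dp_deriv n p);
  dfa_D_fin : forall f, exists s : seq int,
    forall n, n \notin s -> dfa_D n f = 0;
  dfa_S_D : forall n f, dfa_S (dfa_D n f) = dfa_D (n + 1) (dfa_S f)
}.

Definition dfa_u (F : fieldType) (V : comUnitAlgType F) (A : diffFunAlg V) : V :=
  dfa_emb A (dp_var F 0).

(* The relation K(S) xi = H(S) eta for the rational operator                  *)
(*   K(S) = u (S - 1)(S + 1)^-1 u  and  H(S) = S - S^-1.                      *)
(* (S + 1)^-1 need not exist on V, so the denominator is cleared:             *)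
(* S - 1 and S + 1 commute, so u^-1 K(S) = (S + 1)^-1 (S - 1) u.              *)
Definition KH_rel (F : fieldType) (V : comUnitAlgType F) (A : diffFunAlg V)
    (xi eta : V) : Prop :=
  let S := dfa_S A in let Sinv := dfa_Sinv A in let u := dfa_u A in
  (S \- idfun) (u * xi) = (S \+ idfun) (u^-1 * (S \- Sinv) eta).

Definition lenard_magri (V : Type) (rel : V -> V -> Prop) (xi : nat -> V) : Prop :=
  forall j : nat, (0 < j)%N -> rel (xi j) (xi j.-1).

(* Main.v *)
Require Import Defs.
From mathcomp Require Import all_boot all_order all_algebra.
From mathcomp Require Import ring.
Import GRing.Theory.
Local Open Scope ring_scope.

(** Put [w = 1/u], [q_n = S^n (w S(w))], and let [L] be the infinite tridiagonal
    matrix with [L_(n,n+1) = q_n], [L_(n+1,n) = 1] (the Lax matrix of the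
    Volterra lattice, to which [w S(w)] is the Miura map). With
    [xi_j = w p_j] the recursion reads
      [(S - 1) p_j = (S + 1) (q_0 S(p_(j-1)) - q_(-1) S^-1(p_(j-1)))],
    and [p_j = (L^(2j))_(0,0)] solves it: both sides are compared by expanding
    the entries of [L^(2j)] and of the commutator [[L, L^(2j-2)] = 0]. *)

Fixpoint lax_pow {R : comNzRingType} (q : int -> R) (m : nat) (i j : int) : R :=
  if m is m'.+1 then q i * lax_pow q m' (i + 1) j + lax_pow q m' (i - 1) j
  else (i == j)%:R.

Lemma lax_powSl {R : comNzRingType} (q : int -> R) m i j :
  lax_pow q m.+1 i j = q i * lax_pow q m (i + 1) j + lax_pow q m (i - 1) j.
Proof. by []. Qed.

(** The definition peels off the leftmost factor [L], this the rightmost; together they say that [L]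
    commutes with its powers. *)
Lemma lax_powSr {R : comNzRingType} (q : int -> R) m i j :
  lax_pow q m.+1 i j =
  lax_pow q m i (j - 1) * q (j - 1) + lax_pow q m i (j + 1).
Proof.
elim: m i j => [|m IHm] i j.
  rewrite /= subr_eq -[i == j - 1](inj_eq (addIr 1)) subrK.
  case: eqVneq => [<-|_]; last by rewrite mulr0 mul0r.
  by rewrite addrK mulrC.
rewrite lax_powSl (IHm (i + 1)) (IHm (i - 1)) !(lax_powSl q m i).
by ring.
Qed.

(** For [m = 2j - 2] this is the recursion for [p_j], read on matrix entries. *)
Lemma lax_pow_diag {R : comNzRingType} (q : int -> R) m :
  lax_pow q m.+2 1 1 - lax_pow q m.+2 0 0 =
  q 1 * lax_pow q m 2 2 + q 0 * lax_pow q m 1 1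
  - q 0 * lax_pow q m 0 0 - q (-1) * lax_pow q m (-1) (-1).
Proof.
have comm : q 1 * lax_pow q m 2 0 + lax_pow q m 0 0 =
            lax_pow q m 1 (-1) * q (-1) + lax_pow q m 1 1.
  exact: etrans (esym (lax_powSl q m 1 0)) (lax_powSr q m 1 0).
(* One diagonal entry is opened from the left, the other from the right, so that both leave the same
   entry [(0,1)], which cancels; [q 0] times [comm] settles the rest. *)
have -> : lax_pow q m.+2 1 1 =
    q 1 * (lax_pow q m 2 0 * q 0 + lax_pow q m 2 2) + lax_pow q m.+1 0 1.
  by rewrite lax_powSl (lax_powSr q m (1 + 1)).
have -> : lax_pow q m.+2 0 0 =
    (q 0 * lax_pow q m 1 (-1) + lax_pow q m (-1) (-1)) * q (-1)
    + lax_pow q m.+1 0 1.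
  by rewrite lax_powSr (lax_powSl q m 0 (0 - 1)).
by ring: (canRL (addrK _) comm).
Qed.

(** Applying [f] to the entries of [L] translates [L] along its diagonal, hence also its powers. *)
Lemma lax_pow_shift {R : comNzRingType} (f : {rmorphism R -> R}) (q : int -> R) :
  (forall n, f (q n) = q (n + 1)) ->
  forall m i j, f (lax_pow q m i j) = lax_pow q m (i + 1) (j + 1).
Proof.
move=> fq; elim=> [|m IHm] i j /=; first by rewrite rmorph_nat (inj_eq (addIr 1)).
by rewrite rmorphD rmorphM fq !IHm (addrAC i (-1)).
Qed.

(** The integer power [f^n], with [g] as the inverse of [f]; [Negz k] is [-(k+1)], whence [k.+1]. *)
Definition int_iter {T : Type} (f g : T -> T) (n : int) (x : T) : T :=
  match n with Posz k => iter k f x | Negz k => iter k.+1 g x end.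

Lemma int_iterS {T : Type} (f g : T -> T) (n : int) (x : T) :
  cancel g f -> f (int_iter f g n x) = int_iter f g (n + 1) x.
Proof.
move=> gK; case: n => [k|[|k]]; first by rewrite -PoszD addn1.
  exact: gK.
have -> : Negz k.+1 + 1 = Negz k by rewrite !NegzE -addn1 PoszD opprD addrNK.
exact: gK.
Qed.

Theorem proposition4p9 (F : fieldType) (charF : [pchar F] =i pred0)
    (V : comUnitAlgType F) (A : diffFunAlg V)
    (u_unit : dfa_u A \is a GRing.unit) :
  exists xi : nat -> V,
    xi 0%N = (dfa_u A)^-1 /\ lenard_magri (KH_rel A) xi.
Proof.
set u := dfa_u A in u_unit *; set w := u^-1.
pose S := dfa_S A; pose Si := dfa_Sinv A.
pose q n := int_iter S Si n (w * S w).
have qS n : S (q n) = q (n + 1) by apply: int_iterS (dfa_SinvK A).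
have powS := lax_pow_shift S q qS.
have powSi m i j : Si (lax_pow q m i j) = lax_pow q m (i - 1) (j - 1).
  by apply: (can_inj (dfa_SK A)); rewrite dfa_SinvK [RHS]powS !subrK.
exists (fun j => w * lax_pow q j.*2 0 0); split; first by rewrite /= mulr1.
case=> // j _; rewrite /KH_rel doubleS.
change (S (u * (w * lax_pow q j.*2.+2 0 0)) - u * (w * lax_pow q j.*2.+2 0 0) =
  S (w * (S (w * lax_pow q j.*2 0 0) - Si (w * lax_pow q j.*2 0 0)))
  + w * (S (w * lax_pow q j.*2 0 0) - Si (w * lax_pow q j.*2 0 0))).
(* As [u w = 1], the left side is a difference of neighbouring diagonal entries. Writing each [q] as
   a product of shifts of [w] then matches it with the right side. *)
rewrite !mulrA divrr // !mul1r powS lax_pow_diag.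
have -> : q 1 = S w * S (S w) by apply: rmorphM.
have -> : q (-1) = Si w * w by rewrite /q /= rmorphM /= dfa_SK.
have -> : q 0 = w * S w by [].
rewrite !(rmorphM, rmorphB) /= !dfa_SinvK !powS powSi.
ring.
Qed.
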